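(* Let $M\ge 1$ and $\ell\ge 1$ be integers, let $a(x), b(x) \in \mathbb{F}_2^{\langle \ell \rangle}$, let $(\kappa_1,\dots,\kappa_M)$ be an increasing sequence of integers with $\kappa_1=1$, and let $p^{(1)}(x),\dots,p^{(M)}(x)$ be polynomials with $p^{(1)}(x)=1$ and $p^{(m)}(x)\in\mathbb{F}_2^{\langle(\kappa_m-1)\ell+1\rangle}$ for $m=2,\dots,M$. Let $\mathcal{F}=\{\mathcal{Q}_1,\dots,\mathcal{Q}_M\}$ be the family of extended generalized bicycle codes constructed from these data, where $\mathcal{Q}_m$ is an $[[n_m,k_m,d_m]]$ code. Then every code $\mathcal{Q}_m\in\mathcal{F}$, $m=1,\dots,M$, satisfies $k_m\geq k_1$.
   Context: For a positive integer $\ell$, $\mathbb{F}_2^{\langle \ell\rangle}:=\mathbb{F}_2[x]/(x^\ell-1)$; its elements are represented by polynomials $p(x)=p_0+p_1x+\dots+p_{\ell-1}x^{\ell-1}$ of degree at most $\ell-1$ with coefficients in $\mathbb{F}_2$. Such a $p(x)$ corresponds (notation $p(x)\sim P$) to the $\ell\times\ell$ binary circulant matrix $P=\sum_{i=0}^{\ell-1}p_iX^i$, where $X$ is the cyclic shift matrix sending the basis vector $e_k$ to $e_{k+1 \bmod \ell}$; i.e. the first column of $P$ is $(p_0,\dots,p_{\ell-1})^T$ and each column is the cyclic downward shift of the previous one. CSS code: binary matrices $H_X,H_Z$ with $n$ columns satisfying $H_XH_Z^T=0$ over $\mathbb{F}_2$ define a quantum code of length $n$ with parity-check matrix $H=\begin{pmatrix}H_X&0\\0&H_Z\end{pmatrix}$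 and dimension (number of logical qubits) $k=n-\mathrm{rank}(H)$, the rank being over $\mathbb{F}_2$. Its distance $d$ is the minimum weight of a Pauli operator commuting with all elements of the stabilizer group but not belonging to it. One writes $[[n,k,d]]$. Generalized bicycle (GB) code: given $\ell\times\ell$ binary circulant matrices $A\sim a(x)$ and $B\sim b(x)$, it is the CSS code with $H_X=(A|B)$ and $H_Z=(B^T|A^T)$, of length $n=2\ell$. Construction of the family: for $m=1,\dots,M$, set $a^{(m)}(x)=p^{(m)}(x)a(x)\in\mathbb{F}_2^{\langle\kappa_m\ell\rangle}$ and $b^{(m)}(x)=p^{(m)}(x)b(x)\in\mathbb{F}_2^{\langle\kappa_m\ell\rangle}$, where $a(x),b(x),p^{(m)}(x)$ are taken as polynomials of degree at most $\ell-1$, $\ell-1$ and $(\kappa_m-1)\ell$ respectively. Let $A_m\sim a^{(m)}(x)$ and $B_m\sim b^{(m)}(x)$ be the corresponding $\kappa_m\ell\times\kappa_m\ell$ circulant matrices. Then $\mathcal{Q}_m$ is the GB code with parity-check matrix $H_m=\begin{pmatrix}(A_m|B_m)&0\\0&(B_m^T|A_m^T)\end{pmatrix}$, of length $n_m=2\kappa_m\ell$ and dimension $k_m$. In particular $\mathcal{Q}_1$ is the base code defined by $a(x),b(x)$. *)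

(* Defs.v *)
From HB Require Import structures.
From mathcomp Require Export all_boot all_order all_algebra.

Set Implicit Arguments.
Unset Strict Implicit.
Unset Printing Implicit Defensive.

Import GRing.Theory.
Local Open Scope ring_scope.

(* F_2[x]/(x^n - 1). Elements of {poly %/ h} are the reduced representatives
   and coerce to {poly 'F_2}, with size at most n as soon as 0 < n; for n = 0
   the library falls back on the modulus 'X. *)
Definition F2cyc (n : nat) := {poly %/ ('X^n - 1 : {poly 'F_2})}.

(* Maps the basis column vector e_j to e_(j+1 mod n). *)
Definition cyclic_shift (n : nat) : 'M['F_2]_n :=
  \matrix_(i, j) (i == ordS j)%:R.

Definition circulant (n : nat) (p : F2cyc n) : 'M['F_2]_n :=
  \sum_(i < n) (p : {poly 'F_2})`_i *: cyclic_shift n ^+ i.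

Lemma circulant_comm (n : nat) (p q : F2cyc n) :
  circulant p *m circulant q = circulant q *m circulant p.
Proof.
rewrite /circulant mulmx_suml mulmx_sumr; apply: eq_bigr => i _.
rewrite mulmx_suml mulmx_sumr; apply: eq_bigr => j _.
rewrite -!scalemxAl -!scalemxAr !scalerA mulrC; congr (_ *: _).
by rewrite !mulmxE -!exprD addnC.
Qed.

Record css_code (n : nat) := CssCode {
  css_rX : nat;
  css_rZ : nat;
  css_HX : 'M['F_2]_(css_rX, n);
  css_HZ : 'M['F_2]_(css_rZ, n);
  css_orth : css_HX *m css_HZ^T = 0
}.

Definition css_check (n : nat) (C : css_code n) :
    'M['F_2]_(css_rX C + css_rZ C, n + n) :=
  block_mx (css_HX C) 0 0 (css_HZ C).

Lemma css_check_rank (n : nat) (C : css_code n) : (\rank (css_check C) <= n)%N.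
Proof.
rewrite /css_check rank_diag_block_mx -(mxrank_tr (css_HZ C)).
exact: mulmx0_rank_max (css_orth C).
Qed.

(* By css_check_rank the natural-number subtraction never truncates. *)
Definition css_dim (n : nat) (C : css_code n) : nat := n - \rank (css_check C).

Lemma gb_orth (n : nat) (a b : F2cyc n) :
  row_mx (circulant a) (circulant b)
    *m (row_mx (circulant b)^T (circulant a)^T)^T = 0.
Proof.
rewrite tr_row_mx !trmxK mul_row_col (circulant_comm b a).
by apply/matrixP=> i j; rewrite !mxE addrr_pchar2 // pchar_Fp.
Qed.

Definition gb_code (n : nat) (a b : F2cyc n) : css_code (n + n) :=
  CssCode (gb_orth a b).

(* The product is formed on the reduced representatives, taken as ordinary
   polynomials, and then sent to F_2[x]/(x^(kappa l) - 1). *)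
Definition ext_poly (l kappa : nat) (p : F2cyc (kappa.-1 * l + 1))
    (a : F2cyc l) : F2cyc (kappa * l) :=
  in_qpoly _ ((p : {poly 'F_2}) * (a : {poly 'F_2})).

Definition ext_gb_code (l : nat) (a b : F2cyc l) (kappa : nat)
    (p : F2cyc (kappa.-1 * l + 1)) : css_code (kappa * l + kappa * l) :=
  gb_code (ext_poly p a) (ext_poly p b).

(* Main.v *)
(** If [u] is an l-periodic row vector of length kappa l, multiplying it by the
    (kappa l)-circulant of a polynomial [q] amounts to multiplying one period of
    it by the l-circulant of [q mod x^l - 1].  Hence periodic extension sends
    the left kernel of [(A|B)] injectively into that of [(A_m|B_m)], since
    [a^(m) = p^(m) a] and [b^(m) = p^(m) b]; the same holds for
    [(B^T|A^T)], because the transposed shift is the inverse shift.  The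
    dimension of a GB code is the sum of the dimensions of these two kernels. *)
Require Import Defs.
From mathcomp Require Import all_boot all_order all_algebra.
Import GRing.Theory.
Local Open Scope ring_scope.

Lemma horner_mx_intertwine (R : comNzRingType) (m n : nat) (U : 'M[R]_m.+1)
    (V : 'M[R]_n.+1) (L : 'M[R]_(m.+1, n.+1)) (p : {poly R}) :
  L *m V = U *m L -> L *m horner_mx V p = horner_mx U p *m L.
Proof.
move=> LV; elim/poly_ind: p => [|p c IHp]; first by rewrite !rmorph0 mulmx0 mul0mx.
rewrite !rmorphD !rmorphM /= !horner_mx_X !horner_mx_C -!mulmxE mulmxDr mulmxDl.
by rewrite mulmxA IHp -!mulmxA LV scalar_mxC.
Qed.

Lemma horner_mx_tr (R : comNzRingType) (n : nat) (U : 'M[R]_n.+1) (p : {poly R}) :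
  (horner_mx U p)^T = horner_mx U^T p.
Proof.
elim/poly_ind: p => [|p c IHp]; first by rewrite !rmorph0 trmx0.
rewrite !rmorphD !rmorphM /= !horner_mx_X !horner_mx_C -!mulmxE linearD /=.
rewrite trmx_mul tr_scalar_mx IHp; congr (_ + _).
(* Here the intertwiner is [U^T] itself: it commutes with every polynomial in [U^T]. *)
by apply: horner_mx_intertwine.
Qed.

Lemma cyclic_shiftX (n i : nat) (j k : 'I_n) :
  (cyclic_shift n ^+ i) j k = (j == (k + i) %% n :> nat)%N%:R.
Proof.
elim: i j k => [|i IHi] j k.
  by rewrite expr0 addn0 modn_small // -idmxE mxE.
rewrite exprSr -mulmxE mxE (bigD1 (ordS k)) //= big1 => [|t tk].
  by rewrite addr0 IHi mxE eqxx mulr1 /= modnDml addSnnS.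
by rewrite [cyclic_shift _ _ _]mxE (negPf tk) mulr0.
Qed.

Lemma cyclic_shift_tr_mulV (n : nat) : (cyclic_shift n)^T *m cyclic_shift n = 1%:M.
Proof.
apply/matrixP => i j; rewrite !mxE (bigD1 (ordS i)) //= big1 => [|t ti].
  by rewrite !mxE eqxx mul1r addr0 (inj_eq (@ordS_inj n)).
by rewrite !mxE (negPf ti) mul0r.
Qed.

(** The shift is a root of ['X^(n.+1) - 1], so evaluation at it sees only the residue of [q].
    Products of circulants thus become products of polynomials, with no reduction left to track. *)
Lemma horner_cyclic_shift (n : nat) (q : {poly 'F_2}) :
  @circulant n.+1 (in_qpoly _ q) = horner_mx (cyclic_shift n.+1) q.
Proof.
have monh : ('X^(n.+1) - 1 : {poly 'F_2}) \is monic by rewrite -[1]/(1%:P) monicXnsubC.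
have szh : size ('X^(n.+1) - 1 : {poly 'F_2}) = n.+2 by rewrite -[1]/(1%:P) size_XnsubC.
have mkh : mk_monic ('X^(n.+1) - 1 : {poly 'F_2}) = 'X^(n.+1) - 1.
  by rewrite /mk_monic szh monh.
have shift_root : horner_mx (cyclic_shift n.+1) ('X^(n.+1) - 1) = 0.
  rewrite rmorphB rmorphXn rmorph1 /= horner_mx_X; apply/matrixP => i j.
  by rewrite [LHS]mxE cyclic_shiftX modnDr modn_small // !mxE subrr.
rewrite [q in RHS](Pdiv.RingMonic.rdivp_eq monh) rmorphD rmorphM /= shift_root.
rewrite mulr0 add0r /circulant.
set r := Pdiv.CommonRing.rmodp q _.
have -> : in_qpoly ('X^(n.+1) - 1) q = r :> {poly 'F_2} by rewrite /= mkh.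
have szr : (size r <= n.+1)%N.
  by rewrite -ltnS -szh Pdiv.CommonRing.ltn_rmodp // monic_neq0.
(* The expansion of [r] stops at [size r]; it is padded with zero coefficients to the range [n.+1]
   of the circulant sum. *)
rewrite -[r in RHS]coefK (poly_def (size r)) linear_sum /=.
rewrite (big_ord_widen _ (fun i => horner_mx _ (r`_i *: 'X^i)) szr).
rewrite [RHS]big_mkcond /=; apply: eq_bigr => i _.
rewrite linearZ rmorphXn /= horner_mx_X; case: ltnP => // ri.
by rewrite nth_default // scale0r.
Qed.

(** For [n] dividing [N], this is a row of [N %/ n] identity blocks: [u *m periodize n N] repeats
    the row vector [u]. *)
Definition periodize (n N : nat) : 'M['F_2]_(n, N) :=
  \matrix_(i, j) (i == j %% n :> nat)%N%:R.

Section Periodize.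

Variables n N : nat.
Hypotheses (n_gt0 : (0 < n)%N) (N_gt0 : (0 < N)%N) (nN : (n %| N)%N).

Lemma row_free_periodize : row_free (periodize n N).
Proof.
(* The right inverse reads off the first period. *)
apply/row_freeP; exists (\matrix_(j, i) (j == i :> nat)%:R).
apply/matrixP => i k; rewrite !mxE.
have kN : (k < N)%N by rewrite (leq_trans (ltn_ord k)) // dvdn_leq.
rewrite (bigD1 (Ordinal kN)) //= big1 => [|t tk].
  by rewrite !mxE /= eqxx mulr1 addr0 modn_small.
by move: tk; rewrite !mxE -(inj_eq val_inj) /= => /negPf->; rewrite mulr0.
Qed.

Lemma periodize_shift :
  periodize n N *m cyclic_shift N = cyclic_shift n *m periodize n N.
Proof.
apply/matrixP => i j; rewrite !mxE (bigD1 (ordS j)) //= big1 => [|t tj].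
  have jn : (j %% n < n)%N by rewrite ltn_mod.
  rewrite (bigD1 (Ordinal jn)) //= big1 => [|t tj].
    (* Divisibility enters here: wrapping around modulo [N] is invisible modulo [n]. *)
    rewrite !mxE !eqxx /= !mulr1 !addr0 modn_dvdm // -(inj_eq val_inj) /=.
    by rewrite -(addn1 (j %% n)) modnDml addn1.
  by move: tj; rewrite !mxE -(inj_eq val_inj) /= => /negPf->; rewrite mulr0.
by rewrite !mxE (negPf tj) mulr0.
Qed.

Lemma periodize_shift_tr :
  periodize n N *m (cyclic_shift N)^T = (cyclic_shift n)^T *m periodize n N.
Proof.
have shiftVN := mulmx1C (cyclic_shift_tr_mulV N).
rewrite -[LHS]mul1mx -(cyclic_shift_tr_mulV n) -mulmxA (mulmxA (cyclic_shift n)).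
by rewrite -periodize_shift -mulmxA shiftVN mulmx1.
Qed.

End Periodize.

(** Right multiplication by [L] carries the left kernel of [H] into that of [G], and row-freeness
    preserves its rank. *)
Lemma corank_intertwine (F : fieldType) (n N s t : nat) (L : 'M[F]_(n, N))
    (H : 'M[F]_(n, s)) (G : 'M[F]_(N, t)) (Z : 'M[F]_(s, t)) :
  row_free L -> L *m G = H *m Z -> (n - \rank H <= N - \rank G)%N.
Proof.
move=> freeL LG; rewrite -!mxrank_ker -(mxrankMfree _ freeL).
by apply/mxrankS/sub_kermxP; rewrite -mulmxA LG mulmxA mulmx_ker mul0mx.
Qed.

Lemma css_dim_gb_code (n : nat) (a b : F2cyc n) :
  css_dim (gb_code a b)
    = (n - \rank (row_mx (circulant a) (circulant b))
       + (n - \rank (row_mx (circulant b)^T (circulant a)^T)))%N.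
Proof.
rewrite /css_dim /css_check rank_diag_block_mx /=.
by rewrite subnDA addnBAC ?rank_leq_row // addnBA ?rank_leq_row // subnAC.
Qed.

Lemma gb_dim_mul (n N : nat) (r a b : {poly 'F_2}) :
  (0 < n)%N -> (0 < N)%N -> (n %| N)%N ->
  (css_dim (@gb_code n (in_qpoly _ a) (in_qpoly _ b))
    <= css_dim (@gb_code N (in_qpoly _ (r * a)) (in_qpoly _ (r * b))))%N.
Proof.
case: n => // n _; case: N => // N _ nN.
rewrite !css_dim_gb_code !horner_cyclic_shift.
set S := cyclic_shift n.+1; set T := cyclic_shift N.+1.
set L := periodize n.+1 N.+1.
have freeL : row_free L by apply: row_free_periodize.
have LT : L *m T = S *m L by apply: periodize_shift.
have LTt : L *m T^T = S^T *m L by apply: periodize_shift_tr.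
(* Putting [q] evaluated at [U] in front leaves a right factor independent of [q], hence common to
   both blocks of a check matrix. *)
have LC (U : 'M['F_2]_n.+1) (V : 'M['F_2]_N.+1) (q : {poly 'F_2}) :
    L *m V = U *m L ->
  L *m horner_mx V (r * q) = horner_mx U q *m (horner_mx U r *m L).
  move=> LV; rewrite (horner_mx_intertwine _ _ _ _ _ _ _ LV) mulrC rmorphM /=.
  by rewrite -mulmxE mulmxA.
have LRow (U : 'M['F_2]_n.+1) (V : 'M['F_2]_N.+1) (c d : {poly 'F_2}) :
    L *m V = U *m L ->
  (n.+1 - \rank (row_mx (horner_mx U c) (horner_mx U d))
    <= N.+1 - \rank (row_mx (horner_mx V (r * c)) (horner_mx V (r * d))))%N.
  move=> LV; set W := horner_mx U r *m L.
  apply: (corank_intertwine _ _ _ _ _ _ _ _ (block_mx W 0 0 W) freeL).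
  by rewrite mul_mx_row mul_row_block !mulmx0 addr0 add0r !(LC U).
(* [LRow] serves twice: with the shifts, and with their transposes and [a], [b] exchanged. *)
by rewrite !horner_mx_tr leq_add // LRow.
Qed.

Theorem theorem3 (M l : nat) (hM : (1 <= M)%N) (hl : (1 <= l)%N)
  (a b : F2cyc l)
  (kappa : nat -> nat)
  (kappa1 : kappa 1%N = 1%N)
  (kappa_incr : forall i j : nat,
     (1 <= i)%N -> (i < j)%N -> (j <= M)%N -> (kappa i < kappa j)%N)
  (p : forall m : nat, F2cyc ((kappa m).-1 * l + 1))
  (p1 : (p 1%N : {poly 'F_2}) = 1) :
  forall m : nat, (1 <= m <= M)%N ->
    (css_dim (ext_gb_code a b (p 1%N)) <= css_dim (ext_gb_code a b (p m)))%N.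
Proof.
move=> m /andP[m_gt0 mM].
have km_gt0 : (0 < kappa m)%N.
  have [m_gt1|m_le1] := ltnP 1 m.
    by apply: leq_trans (kappa_incr 1%N m isT m_gt1 mM).
  by have /eqP-> : m == 1%N; rewrite ?eqn_leq ?m_le1 // kappa1.
rewrite /ext_gb_code /ext_poly p1 !mul1r.
(* The base length stays [kappa 1 * l], on which the types depend; [kappa1] rewrites only the
   arithmetic side conditions. *)
by apply: gb_dim_mul; rewrite ?muln_gt0 ?km_gt0 ?kappa1 ?mul1n ?dvdn_mull.
Qed.
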